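(* Let $p>0$, $u$ a weight on $\mathbb R$ and $w$ a weight on $(0,\infty)$. If $H:\Lambda^p_u(w)\to\Lambda^{p,\infty}_u(w)$ is bounded, then $M:\Lambda^p_u(w)\to\Lambda^{p,\infty}_u(w)$ is bounded.
   Context: A weight $u$ on $\mathbb R$ is locally integrable with $u>0$ a.e.; $u(E)=\int_Eu$. A weight $w$ on $(0,\infty)$ is nonnegative locally integrable, $W(t)=\int_0^tw$. $f^*_u(t)=\inf\{y>0:u(\{|f|>y\})\le t\}$; $\|f\|_{\Lambda^p_u(w)}=\left(\int_0^\infty(f^*_u)^pw\right)^{1/p}$, $\|f\|_{\Lambda^{p,\infty}_u(w)}=\sup_{t>0}f^*_u(t)W(t)^{1/p}$. $Hf(x)=\frac1\pi\lim_{\varepsilon\to0^+}\int_{|x-y|>\varepsilon}\frac{f(y)}{x-y}dy$; boundedness of $H$ means $Hf$ defined a.e. for every $f\in\Lambda^p_u(w)$ with $\|Hf\|_{\Lambda^{p,\infty}_u(w)}\le C\|f\|_{\Lambda^p_u(w)}$. $Mf(x)=\sup_{I\ni x}\frac1{|I|}\int_I|f|$ over intervals $I$ containing $x$; boundedness of $M$ means $\|Mf\|_{\Lambda^{p,\infty}_u(w)}\le C\|f\|_{\Lambda^p_u(w)}$. *)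

(* Defs.v *)
From HB Require Import structures.
From mathcomp Require Import all_boot all_order all_algebra.
From mathcomp Require Import all_classical all_reals all_analysis.
Set Implicit Arguments. Unset Strict Implicit. Unset Printing Implicit Defensive.
Import Order.TTheory GRing.Theory Num.Theory.
Import numFieldNormedType.Exports.
Local Open Scope classical_set_scope.
Local Open Scope ring_scope.

Section Defs.
Variable R : realType.
Local Notation mu := (@lebesgue_measure R).

Definition Ioc0 (t : R) : set R := `]0, t].
Definition Icc (a b : R) : set R := `[a, b].

Definition weightR (u : R -> R) : Prop :=
  (forall a b : R, mu.-integrable `[a, b] (fun x => (u x)%:E)) /\
  {ae mu, forall x, 0 < u x}.

Definition weightRplus (w : R -> R) : Prop :=
  (forall t : R, 0 < t -> 0 <= w t) /\
  (forall t : R, 0 < t -> mu.-integrable `]0, t] (fun s => (w s)%:E)).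

Definition umeas (u : R -> R) (E : set R) : \bar R :=
  (\int[mu]_(x in E) (u x)%:E)%E.

Definition Wfun (w : R -> R) (t : R) : \bar R :=
  (\int[mu]_(s in (Ioc0 t)) (w s)%:E)%E.

(* decreasing rearrangement of g w.r.t. u:
   g^*_u(t) = inf { y > 0 : u({|g| > y}) <= t } (inf of empty set = +oo) *)
Definition rearr (u : R -> R) (g : R -> \bar R) (t : R) : \bar R :=
  ereal_inf [set y%:E | y in [set y : R | 0 < y /\
     (umeas u [set x | (y%:E < `|g x|)%E] <= t%:E)%E]].

Definition lorentz_norm (p : R) (u w : R -> R) (g : R -> \bar R) : \bar R :=
  poweR (\int[mu]_(t in [set t : R | (0 < t)%R]) (poweR (rearr u g t) p * (w t)%:E))%E
        p^-1.

Definition weak_lorentz_norm (p : R) (u w : R -> R) (g : R -> \bar R) : \bar R :=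
  ereal_sup [set (rearr u g t * poweR (Wfun w t) p^-1)%E |
              t in [set t : R | 0 < t]].

Definition in_lorentz (p : R) (u w : R -> R) (f : R -> R) : Prop :=
  measurable_fun setT f /\
  (lorentz_norm p u w (fun x => (f x)%:E) < +oo)%E.

Definition pv_cauchy (f : R -> R) (x l : R) : Prop :=
  (\forall e \near 0^'+,
      mu.-integrable [set y | e < `|x - y|] (fun y => (f y / (x - y))%:E)) /\
  ((fun e => fine (\int[mu]_(y in [set y | (e < `|x - y|)%R]) (f y / (x - y))%:E)%E)
     @ 0^'+ --> l).

(* g is (a representative of) the Hilbert transform of f:
   Hf(x) = (1/pi) lim_{eps->0+} int_{|x-y|>eps} f(y)/(x-y) dy for a.e. x *)
Definition is_hilbert (f g : R -> R) : Prop :=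
  {ae mu, forall x, pv_cauchy f x (pi * g x)}.

Definition maximal (f : R -> R) (x : R) : \bar R :=
  ereal_sup [set (((ab.2 - ab.1)^-1)%:E *
                  \int[mu]_(y in (Icc ab.1 ab.2)) (`|f y|)%:E)%E |
              ab in [set ab : R * R | ab.1 < ab.2 /\ ab.1 <= x <= ab.2]].

End Defs.

(* Main.v *)
Require Import Defs.
From HB Require Import structures.
From mathcomp Require Import all_boot all_order all_algebra.
From mathcomp Require Import all_classical all_reals all_analysis.
From mathcomp Require Import measurable_realfun.
From mathcomp Require Import ring lra.
Set Implicit Arguments. Unset Strict Implicit. Unset Printing Implicit Defensive.
Import Order.TTheory GRing.Theory Num.Theory.
Import numFieldNormedType.Exports.
Local Open Scope classical_set_scope.
Local Open Scope ring_scope.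

(* Write [nu E] for the u-measure of E and [V t = W(t)^(1/p)], so that the norm of
   the indicator of E is [V (nu E)].

   Random signs.  Let h_1, ..., h_n be such that every signed sum of them is
   dominated by F, and let G be a set each point of which sees some j with
   |H h_j| >= c.  Changing the sign of h_j moves the Hilbert transform of the signed
   sum by 2 H h_j, so at every point of G at least half of the sign patterns give a
   value >= c.  Averaging over the patterns, one of them does so on a set of
   u-measure at least [nu G / 2], whence [c V(t) <= C |F|] for [2 t < nu G].
   Interference between distant pieces thus never matters.

   Doubling.  The function 1 has no Hilbert transform, so u has infinite mass. An
   interval I with nu I = 8 t contains an interval Q with |Q| = |I| / 27 and
   nu Q <= t; testing on the indicator of Q yields V(2 t) <= 27 pi C V(t).

   Conclusion.  Up to small u-measure, {Mf > l} is covered by the triples of finitely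
   many disjoint intervals I_j on which |f| has average > l.  Let H_j be a half of I_j
   carrying half of the mass of |f| and O_j a quarter of I_j disjoint from H_j.
   Testing on the |f| 1_(H_j) controls the union of the 3 I_j \ H_j, which contains
   the O_j, and testing on the 1_(O_j) controls the union of the 3 I_j \ O_j.
   Doubling glues the two bounds together. *)

(** * The weight as a measure *)

Section density_measure.
Local Open Scope ereal_scope.
Context (R : realType).
Local Notation mu := (@lebesgue_measure R).

(** The absolute value yields a measure for any measurable density, a weight being positive only
    almost everywhere. The measurability proof is an argument so that the measure structure can be
    attached to the term. *)
Definition absdens (u : R -> R) (um : measurable_fun setT u) (A : set R) : \bar R :=
  \int[mu]_(x in A) (`|u x|%R)%:E.

Context (u : R -> R) (um : measurable_fun setT u).

Let absdens0 : absdens um set0 = 0.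
Proof. by rewrite /absdens integral_set0. Qed.

Let absdens_ge0 A : 0 <= absdens um A.
Proof. by apply: integral_ge0 => x _; rewrite lee_fin. Qed.

Lemma measurable_absEFin (D : set R) : measurable_fun D (fun x => (`|u x|%R)%:E : \bar R).
Proof.
apply: measurable_funTS; apply/measurable_EFinP.
exact: measurableT_comp (@normr_measurable R setT) um.
Qed.

Let absdens_sigma_additive : semi_sigma_additive (absdens um).
Proof.
move=> /= A mA tA mUA.
rewrite /absdens/= ge0_integral_bigcup//=; last exact: measurable_absEFin.
apply: is_cvg_ereal_nneg_natsum_cond => n _ _.
by apply: integral_ge0 => /= x ?; rewrite lee_fin.
Qed.

HB.instance Definition _ := isMeasure.Build _ _ _
  (absdens um) absdens0 absdens_ge0 absdens_sigma_additive.

End density_measure.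
Arguments absdens {R u} um A.

Lemma weightR_measurable (R : realType) (u : R -> R) :
  weightR u -> measurable_fun setT u.
Proof.
move=> [ui _]; rewrite -(@bigcup_itvT R true false).
apply/measurable_fun_bigcup => // i.
by have /measurable_int/measurable_EFinP := ui (- i%:R) i%:R.
Qed.

Section umeas.
Local Open Scope ereal_scope.
Context (R : realType) (u : R -> R).
Hypothesis wu : weightR u.
Local Notation mu := (@lebesgue_measure R).
Local Notation nu := (absdens (weightR_measurable wu)).

Lemma umeasE (A : set R) : measurable A -> umeas u A = nu A.
Proof.
move=> mA; apply: ae_eq_integral => //.
- by apply: measurable_funTS; apply/measurable_EFinP; exact: weightR_measurable.
- by apply: measurable_absEFin; exact: weightR_measurable.
- case: wu => _ [N [mN N0 sN]]; exists N; split => // x /= ux; apply: sN => /= u0.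
  by apply: ux => _; rewrite gtr0_norm.
Qed.

Lemma umeas_itv_lty (a b : R) : nu `[a, b] < +oo.
Proof. by have /integrableP[] := proj1 wu a b. Qed.

End umeas.

(* No measurability is needed: for nonnegative functions the integral is a supremum over simple minorants. *)
Lemma nneg_le_integral (d : measure_display) (T : measurableType d) (R : realType)
    (mu : {measure set T -> \bar R}) (D : set T) (f g : T -> \bar R) :
  (forall x, D x -> 0 <= f x <= g x)%E ->
  (\int[mu]_(x in D) f x <= \int[mu]_(x in D) g x)%E.
Proof.
move=> fg.
rewrite !ge0_integralE; first last.
- by move=> x /fg /andP[].
- by move=> x /fg /andP[]; exact: le_trans.
apply: ge_ereal_sup => _ [h hf <-]; apply: ereal_sup_ubound; exists h => // x.
apply: (le_trans (hf x)); rewrite /patch; case: ifPn => // /set_mem Dx.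
by have /andP[] := fg _ Dx.
Qed.

Lemma ge0_le_poweR (R : realType) (r : R) (x y : \bar R) :
  ((0 <= r)%R -> 0 <= x -> x <= y -> poweR x r <= poweR y r)%E.
Proof.
move=> r0 x0 xy; apply: (gt0_ler_poweR _ _ _ xy); first by [].
  by rewrite in_itv/= x0 leey.
by rewrite in_itv/= leey (le_trans x0).
Qed.

(** * Rearrangements, Lorentz norms and the primitive of [w] *)

Section lorentz.
Local Open Scope ereal_scope.
Context (R : realType) (p : R) (u w : R -> R).
Hypotheses (p0 : (0 < p)%R) (wu : weightR u) (ww : weightRplus w).
Local Notation mu := (@lebesgue_measure R).
Local Notation nu := (absdens (weightR_measurable wu)).

Lemma rearr_ge0 (g : R -> \bar R) t : 0 <= rearr u g t.
Proof. by apply: le_ereal_inf_tmp => _ [y [y0 _] <-]; rewrite lee_fin ltW. Qed.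

Lemma le_rearr (g h : R -> \bar R) t :
  measurable_fun setT g -> measurable_fun setT h ->
  (forall x, `|g x| <= `|h x|) -> rearr u g t <= rearr u h t.
Proof.
move=> mg mh gh; apply: ereal_inf_le_tmp => _ [y [y0 yt] <-]; exists y => //; split=> //.
apply: le_trans yt.
have mS (k : R -> \bar R) : measurable_fun setT k -> measurable [set x | y%:E < `|k x|].
  move=> mk; rewrite -[X in measurable X]setTI.
  by apply: emeasurable_fun_o_infty => //; exact: measurableT_comp.
rewrite !(umeasE wu); [|exact: mS..].
by apply: le_measure; rewrite ?inE; [exact: mS..|move=> x /= /lt_le_trans; exact].
Qed.

Lemma le_lorentz_norm (g h : R -> \bar R) :
  measurable_fun setT g -> measurable_fun setT h ->
  (forall x, `|g x| <= `|h x|) -> lorentz_norm p u w g <= lorentz_norm p u w h.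
Proof.
move=> mg mh gh.
have I0 (k : R -> \bar R) :
    0 <= \int[mu]_(t in [set t : R | (0 < t)%R]) (poweR (rearr u k t) p * (w t)%:E).
  apply: integral_ge0 => t t0.
  by rewrite mule_ge0 ?poweR_ge0// lee_fin; exact: ww.1.
rewrite /lorentz_norm; apply: ge0_le_poweR; [by rewrite invr_ge0 ltW|exact: I0|].
apply: nneg_le_integral => t t0; apply/andP; split.
  by rewrite mule_ge0 ?poweR_ge0// lee_fin; exact: ww.1.
apply: lee_wpmul2r; first by rewrite lee_fin; exact: ww.1.
by apply: ge0_le_poweR; [exact: ltW|exact: rearr_ge0|exact: le_rearr].
Qed.

Lemma Wfun_ge0 t : 0 <= Wfun w t.
Proof.
apply: integral_ge0 => s; rewrite /Ioc0/= in_itv/= => /andP[s0 _].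
by rewrite lee_fin; exact: ww.1.
Qed.

Lemma Wfun0 : Wfun w 0 = 0.
Proof. by rewrite /Wfun /Ioc0 set_itvoc0 integral_set0. Qed.

Lemma Wfun_lty t : Wfun w t < +oo.
Proof.
have [t0|t0] := ltP 0%R t; last first.
  by rewrite /Wfun /Ioc0 set_itv_ge ?integral_set0 ?bnd_simp -?leNgt.
by apply: integrable_lty; [exact: measurable_itv|exact: (proj2 ww _ t0)].
Qed.

Lemma le_Wfun s t : (s <= t)%R -> Wfun w s <= Wfun w t.
Proof.
move=> st; have [t0|t0] := ltP 0%R t; last first.
  by rewrite /Wfun /Ioc0 !set_itv_ge ?bnd_simp -?leNgt// (le_trans st).
apply: ge0_subset_integral; rewrite /Ioc0; [exact: measurable_itv..| | |].
- by have /measurable_int := proj2 ww _ t0.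
- by move=> x /=; rewrite in_itv/= => /andP[x0 _]; rewrite lee_fin; exact: ww.1.
- by apply: subset_itvl; rewrite bnd_simp.
Qed.

(** The level set of the indicator above [y] is [E] for [0 < y < 1] and empty for [y >= 1]. So
    either every [y > 0] is admissible in the infimum, or exactly those with [y >= 1]. *)
Lemma rearr_indic (E : set R) t : measurable E -> (0 < t)%R ->
  rearr u (fun x => (\1_E x : R)%:E) t = if t%:E < nu E then 1 else 0.
Proof.
move=> mE t0.
have big (y : R) : (1 <= y)%R -> [set x | y%:E < `|(\1_E x : R)%:E|] = set0.
  move=> y1; rewrite -subset0 => x /=; rewrite lte_fin ger0_norm// ltNge.
  by rewrite (le_trans _ y1)// indicE; case: (x \in E).
have small (y : R) : (0 < y < 1)%R -> [set x | y%:E < `|(\1_E x : R)%:E|] = E.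
  move=> /andP[y0 y1]; apply/seteqP; split=> x /=; rewrite lte_fin ger0_norm// indicE.
    by case: (boolP (x \in E)) => [/set_mem//|_ /=]; rewrite ltNge (ltW y0).
  by move=> /mem_set ->.
case: ifPn => [tE|]; [|rewrite -leNgt => Et]; apply/eqP; rewrite eq_le; apply/andP; split.
- apply: ereal_inf_lbound; exists 1%R => //; split => //.
  by rewrite big// /umeas integral_set0 lee_fin ltW.
- apply: le_ereal_inf_tmp => _ [y [y0 +] <-]; rewrite lee_fin.
  case: (ltP y 1%R) => // y1; rewrite small ?y0// (umeasE wu)//.
  by rewrite leNgt tE.
- apply/lee_addgt0Pr => e e0; rewrite add0e.
  (* An admissible level below both 1 and the given [e], which forces the infimum to be 0. *)
  pose y : R := Order.min e (2^-1)%R.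
  have y0 : (0 < y < 1)%R by rewrite /y lt_min e0 invr_gt0 ltr0n/= gt_min invf_lt1 ?ltr1n ?orbT.
  have /andP[yp _] := y0.
  apply: (@le_trans _ _ y%:E); last by rewrite lee_fin /y ge_min lexx.
  by apply: ereal_inf_lbound; exists y => //; split=> //; rewrite small// (umeasE wu).
- exact: rearr_ge0.
Qed.

(** The rearrangement of the indicator is the indicator of []0, nu E[], so the norm integral is that
    of [w] over this interval. *)
Lemma lorentz_norm_indic (E : set R) : measurable E -> nu E < +oo ->
  lorentz_norm p u w (fun x => (\1_E x : R)%:E) = poweR (Wfun w (fine (nu E))) p^-1.
Proof.
move=> mE Efin; congr (poweR _ _).
have En : nu E \is a fin_num by rewrite ge0_fin_numE.
set s := fine (nu E).
have s0 : (0 <= s)%R by exact: fine_ge0.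
transitivity (\int[mu]_(t in [set t : R | (0 < t)%R]) ((fun t => (w t)%:E) \_ `]0%R, s[) t).
  apply: eq_integral => t /[!inE]/= t0; rewrite rearr_indic// patchE.
  rewrite -(fineK En) lte_fin mem_setE in_itv/= t0/= -/s.
  case: ifPn => _; first by rewrite poweR1r mul1e.
  by rewrite poweR0r ?mul0e// gt_eqF.
(* The rearrangement gives an interval open at [s], whereas [Wfun] uses a closed one; the endpoint
   is a null set. *)
rewrite -integral_mkcondr (_ : _ `&` _ = `]0%R, s[%classic); last first.
  by apply/seteqP; split=> x /=; rewrite in_itv/=; [case|move=> /andP[-> ->]].
rewrite integral_itv_bndo_bndc//.
have [sp|sn] := ltP 0%R s; last first.
  by rewrite set_itv_ge ?bnd_simp -?leNgt//; exact: measurable_fun_set0.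
apply: (@measurable_funS _ _ _ _ `]0%R, s]) => //.
  by apply: subset_itvl; rewrite bnd_simp.
by have /measurable_int := proj2 ww _ sp.
Qed.

End lorentz.

(** * Truncated Cauchy integrals and principal values *)

Section pv.
Context (R : realType).
Local Notation mu := (@lebesgue_measure R).

(* Conditional on integrability, so that h need not be known to be locally integrable. *)
Definition truncated_cauchy_ge (h : R -> R) (x K : R) : Prop :=
  exists2 e0 : R, 0 < e0 & forall e, 0 < e < e0 ->
    mu.-integrable [set y | e < `|x - y|] (fun y => (h y / (x - y))%:E) ->
    K <= `|fine (\int[mu]_(y in [set y | (e < `|x - y|)%R]) (h y / (x - y))%:E)%E|.

Lemma measurable_trunc (x e : R) : measurable [set y : R | e < `|x - y|].
Proof.
rewrite -[X in measurable X]setTI.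
have -> : [set y : R | e < `|x - y|] = (fun y => `|x - y|) @^-1` `]e, +oo[.
  by apply/seteqP; split => y /=; rewrite in_itv/= andbT.
have mn : measurable_fun setT (fun y : R => `|x - y|).
  apply: (measurableT_comp (@normr_measurable R setT)).
  by apply: measurable_funB.
exact: mn.
Qed.

(** For small [e] the truncated kernels of [g1] and [g2] are integrable, hence so is that of [h],
    which equals their difference divided by [2 * s]. The bound on the truncations of [h] thus
    becomes available and survives the limit. *)
Lemma pv_cauchy_diff (g1 g2 h : R -> R) (s x l1 l2 K : R) :
  pv_cauchy g1 x l1 -> pv_cauchy g2 x l2 -> `|s| = 1 ->
  (forall y, g1 y - g2 y = 2 * s * h y) ->
  truncated_cauchy_ge h x K -> 2 * K <= `|l1 - l2|.
Proof.
move=> [i1 c1] [i2 c2] s1 gh [e0 e00 hK].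
pose F g e := fine (\int[mu]_(y in [set y | (e < `|x - y|)%R]) (g y / (x - y))%:E)%E.
have c12 : `|F g1 e - F g2 e| @[e --> 0^'+] --> `|l1 - l2|.
  by apply: cvg_norm; apply: cvgB.
rewrite -(cvg_lim _ c12)//; apply: limr_ge; first by apply/cvg_ex; exists `|l1 - l2|.
near=> e.
have mD := measurable_trunc x e.
have I1 : mu.-integrable [set y | e < `|x - y|] (fun y => (g1 y / (x - y))%:E) by near: e.
have I2 : mu.-integrable [set y | e < `|x - y|] (fun y => (g2 y / (x - y))%:E) by near: e.
have s0 : s != 0 by rewrite -normr_eq0 s1 oner_eq0.
have hE y : (h y / (x - y))%:E =
    ((2 * s)^-1%:E * ((g1 y / (x - y))%:E - (g2 y / (x - y))%:E))%E.
  rewrite -EFinB -EFinM -mulrBl gh; congr (_%:E).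
  by rewrite -[2 * s * h y / _]mulrA mulKf// mulf_neq0// pnatr_eq0.
have Ih : mu.-integrable [set y | e < `|x - y|] (fun y => (h y / (x - y))%:E).
  have : mu.-integrable [set y | e < `|x - y|] (fun y =>
      ((2 * s)^-1%:E * ((g1 y / (x - y))%:E - (g2 y / (x - y))%:E))%E).
    by apply: integrableZl => //; apply: integrableB.
  by apply: eq_integrable => // y _; rewrite -hE.
have := hK e; rewrite -/(F h e).
have -> : F h e = (2 * s)^-1 * (F g1 e - F g2 e).
  transitivity (fine (\int[mu]_(y in [set y | (e < `|x - y|)%R])
      ((2 * s)^-1%:E * ((g1 y / (x - y))%:E - (g2 y / (x - y))%:E)))%E).
    by congr fine; apply: eq_integral => y _; exact: hE.
  rewrite integralZl//; last exact: integrableB.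
  rewrite integralB// -fineB; [|exact: integrable_fin_num..].
  rewrite fineM// fin_numB; apply/andP.
  by split; exact: integrable_fin_num.
rewrite normrM normfV normrM s1 mulr1 ger0_norm// => /(_ _ Ih).
rewrite ler_pdivlMl//; apply.
by apply/andP; split; near: e; [exact: nbhs_right_gt|exact: nbhs_right_lt].
Unshelve. all: by end_near. Qed.

End pv.

(** * Averaging over finite families and sign patterns *)

Lemma measure_bigsetU_eq0 (d : measure_display) (T : measurableType d) (R : realType)
    (m : {measure set T -> \bar R}) (I : finType) (N : I -> set T) :
  (forall i, measurable (N i)) -> (forall i, m (N i) = 0%E) ->
  m (\big[setU/set0]_(i : I) N i) = 0%E.
Proof.
move=> mN N0; apply: (proj2 (_ : measurable _ /\ _)).
apply: (big_ind (fun A => measurable A /\ m A = 0%E)) => [|A B [mA A0] [mB B0]|//].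
  by split => //; exact: measure0.
split; first exact: measurableU.
apply/eqP; rewrite -measure_le0; apply: le_trans (measureU2 m mA mB) _.
by rewrite [X in (X + _)%E]A0 [X in (_ + X)%E]B0 adde0.
Qed.

(** Integrating the pointwise bound over [D] gives [#|I| m(D) <= 2 sum_i m(A i) <= 2 #|I| t]; then
    divide by [#|I|]. *)
Lemma measure_le_half_covered (d : measure_display) (T : measurableType d) (R : realType)
    (m : {measure set T -> \bar R}) (I : finType) (A : I -> set T) (D : set T) (t : R) :
  (0 < #|I|)%N -> measurable D -> (forall i, measurable (A i)) ->
  (forall x, D x -> #|I|%:R <= 2 * \sum_(i : I) (\1_(A i) x : R)) ->
  (forall i, (m (A i) <= t%:E)%E) -> (m D <= (2 * t)%:E)%E.
Proof.
move=> I0 mD mA cov At.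
have c0 : (0 : R) < #|I|%:R by rewrite ltr0n.
rewrite -(@lee_pmul2l _ #|I|%:R%:E) ?lte_fin//.
rewrite -integral_cst//.
apply: (@le_trans _ _ (\int[m]_(x in D) (2%:E * \sum_(i : I) (\1_(A i) x : R)%:E))%E).
  apply: nneg_le_integral => x Dx; rewrite lee_fin ler0n/=.
  by rewrite sumEFin -EFinM lee_fin; exact: cov.
rewrite ge0_integralZl//; first last.
- by move=> x _; apply: sume_ge0 => i _; rewrite lee_fin.
- apply: emeasurable_sum => i; apply/measurable_EFinP.
  by apply: measurable_funTS; exact: measurable_indic.
rewrite ge0_integral_sum//; last first.
  by move=> i; apply/measurable_EFinP; apply: measurable_funTS; exact: measurable_indic.
apply: (@le_trans _ _ (2%:E * \sum_(i : I) t%:E)%E).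
  apply: lee_pmul => //; first by apply: sume_ge0 => i _; apply: integral_ge0 => x _; rewrite lee_fin.
  apply: lee_sum => i _; rewrite integral_indic//.
  by apply: le_trans (At i); apply: le_measure; rewrite ?inE//; exact: measurableI.
rewrite sumEFin -!EFinM lee_fin sumr_const -mulr_natr (_ : #|xpredT| = #|I|)//.
by rewrite le_eqVlt; apply/orP; left; apply/eqP; ring.
Qed.

Section signs.
Context (R : realType) (n : nat).
Implicit Types (e : {ffun 'I_n -> bool}).

Definition flip (j : 'I_n) e : {ffun 'I_n -> bool} :=
  [ffun i => if i == j then ~~ e i else e i].

Lemma flipK j : involutive (flip j).
Proof. by move=> e; apply/ffunP => i; rewrite !ffunE; case: eqP => // _; rewrite negbK. Qed.

Definition signed_sum (h : 'I_n -> R -> R) e (x : R) : R :=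
  \sum_(i < n) (-1) ^+ e i * h i x.

Lemma signed_sum_flip (h : 'I_n -> R -> R) j e x :
  signed_sum h e x - signed_sum h (flip j e) x = 2 * (-1) ^+ e j * h j x.
Proof.
rewrite /signed_sum (bigD1 j)//= [X in _ - X](bigD1 j)//= ffunE eqxx signrN.
rewrite [X in _ - (_ + X)](eq_bigr (fun i => (-1) ^+ e i * h i x)); last first.
  by move=> i /negbTE ij; rewrite ffunE ij.
by ring.
Qed.

End signs.

(** * The weak-type bound from random signs *)

Section key.
Local Open Scope ereal_scope.
Context (R : realType) (p : R) (u w : R -> R) (C : R).
Hypotheses (p0 : (0 < p)%R) (wu : weightR u) (ww : weightRplus w) (C0 : (0 <= C)%R).
Hypothesis Hbd : forall f : R -> R, in_lorentz p u w f ->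
  exists Hf : R -> R, measurable_fun setT Hf /\ is_hilbert f Hf /\
    weak_lorentz_norm p u w (fun x => (Hf x)%:E)
      <= C%:E * lorentz_norm p u w (fun x => (f x)%:E).
Local Notation mu := (@lebesgue_measure R).
Local Notation nu := (absdens (weightR_measurable wu)).

Lemma measurable_norm_ge (g : R -> R) (c : R) : measurable_fun setT g ->
  measurable [set x | (c <= `|g x|)%R].
Proof.
move=> mg; rewrite -[X in measurable X]setTI.
have mn : measurable_fun setT (fun x => `|g x|%R).
  exact: measurableT_comp (@normr_measurable R setT) mg.
have -> : [set x | (c <= `|g x|)%R] = (fun x => `|g x|%R) @^-1` `[c, +oo[.
  by apply/seteqP; split => x /=; rewrite in_itv/= andbT.
exact: mn.
Qed.

(** A level [y < c] is not admissible in the infimum defining the rearrangement at [t], since the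
    set above [y] contains the one where [|g| >= c]. Hence the rearrangement at [t] is at least
    [c]. *)
Lemma weak_lorentz_ge (g : R -> R) (c t : R) : measurable_fun setT g ->
  (0 < t)%R -> t%:E < nu [set x | (c <= `|g x|)%R] ->
  c%:E * poweR (Wfun w t) p^-1 <= weak_lorentz_norm p u w (fun x => (g x)%:E).
Proof.
move=> mg t0 tg.
apply: (@le_trans _ _ (rearr u (fun x => (g x)%:E) t * poweR (Wfun w t) p^-1)); last first.
  by apply: ereal_sup_ubound; exists t.
apply: lee_wpmul2r; first exact: poweR_ge0.
apply: le_ereal_inf_tmp => _ [y [y0 yt] <-]; rewrite lee_fin leNgt; apply/negP => yc.
move: yt; apply/negP; rewrite -ltNge; apply: (lt_le_trans tg).
have mS : measurable [set x | y%:E < `|(g x)%:E| ].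
  rewrite -[X in measurable X]setTI; apply: emeasurable_fun_o_infty => //.
  by apply: measurableT_comp => //; exact/measurable_EFinP.
rewrite (umeasE wu)//; apply: le_measure; rewrite ?inE//.
- exact: measurable_norm_ge.
- by move=> x /=; rewrite lte_fin; exact: lt_le_trans.
Qed.

Lemma signs_weak_type (n : nat) (h : 'I_n -> R -> R) (F : R -> R) (G : set R) (c t : R) :
  (forall i, measurable_fun setT (h i)) -> in_lorentz p u w F ->
  (forall e x, (`|signed_sum h e x| <= `|F x|)%R) ->
  measurable G ->
  (forall x, G x -> exists j, truncated_cauchy_ge (h j) x (pi * c)) ->
  (0 < t)%R -> (2 * t)%:E < nu G ->
  c%:E * poweR (Wfun w t) p^-1 <= C%:E * lorentz_norm p u w (fun x => (F x)%:E).
Proof.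
move=> mh [mF NF] hF mG Gh t0 tG.
have mss e : measurable_fun setT (signed_sum h e).
  by apply: measurable_sum => i; apply: measurable_funM.
have mEss e : measurable_fun setT (fun x => (signed_sum h e x)%:E).
  exact/measurable_EFinP.
have mEF : measurable_fun setT (fun x => (F x)%:E) by exact/measurable_EFinP.
have Nle e : lorentz_norm p u w (fun x => (signed_sum h e x)%:E)
    <= lorentz_norm p u w (fun x => (F x)%:E).
  by apply: le_lorentz_norm => // x; rewrite lee_fin.
have /choice[k kP] : forall e, exists Hf : R -> R, measurable_fun setT Hf /\
    is_hilbert (signed_sum h e) Hf /\
    weak_lorentz_norm p u w (fun x => (Hf x)%:E)
      <= C%:E * lorentz_norm p u w (fun x => (signed_sum h e x)%:E).
  by move=> e; apply: Hbd; split; [exact: mss|exact: (le_lt_trans (Nle e) NF)].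
have /choice[N NP] : forall e, exists N : set R, [/\ measurable N, mu N = 0 &
    forall x, ~ N x -> pv_cauchy (signed_sum h e) x (pi * k e x)%R].
  move=> e; have [_ [[N [mN N0 sN]] _]] := kP e; exists N; split => // x Nx.
  by apply: contrapT => pvx; apply: Nx; exact: sN.
(* Outside this finite union of null sets, the principal values exist for all sign patterns at
   once. *)
pose NN := \big[setU/set0]_(e : {ffun 'I_n -> bool}) N e.
have mN e : measurable (N e) by have [] := NP e.
have mNN : measurable NN by exact: bigsetU_measurable.
have muNN : mu NN = 0.
  by apply: measure_bigsetU_eq0 => e; have [] := NP e.
pose A e := [set x | (c <= `|k e x|)%R].
have mA e : measurable (A e) by apply: measurable_norm_ge; have [] := kP e.
(* Either one pattern has a large level set and gives the bound, or all level sets have measure at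
   most [t] and averaging contradicts the size of [G]. *)
have [[e te]|allA] := pselect (exists e, t%:E < nu (A e)).
  apply: (@le_trans _ _ (weak_lorentz_norm p u w (fun x => (k e x)%:E))).
    by apply: weak_lorentz_ge => //; have [] := kP e.
  apply: (@le_trans _ _ (C%:E * lorentz_norm p u w (fun x => (signed_sum h e x)%:E))).
    by have [_ []] := kP e.
  by apply: lee_wpmul2l => //; rewrite lee_fin.
exfalso; move: tG; apply/negP; rewrite -leNgt.
(* The u-measure is absolutely continuous with respect to Lebesgue measure. *)
have -> : nu G = nu (G `\` NN).
  apply: ge0_negligible_integral => //; first exact: measurable_absEFin (weightR_measurable wu) _.
apply: (@measure_le_half_covered _ _ _ _ _ A) => //.
- by apply/card_gt0P; exists [ffun=> false].
- exact: measurableD.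
- move=> x [Gx Nx]; have [j hj] := Gh _ Gx.
  have pvx e : pv_cauchy (signed_sum h e) x (pi * k e x)%R.
    have [_ _] := NP e; apply => Ne; apply: Nx.
    by rewrite /NN; rewrite (bigD1 e)//=; left.
  (* Two numbers at distance at least [2 * c] cannot both have absolute value below [c], so one of
     [e] and [flip j e] is good at [x]. *)
  have pair e : (1 <= \1_(A e) x + (\1_(A (flip j e)) x : R))%R.
    have : (2 * (pi * c) <= `|pi * k e x - pi * k (flip j e) x|)%R.
      apply: (pv_cauchy_diff (pvx e) (pvx (flip j e)) _ (signed_sum_flip h j e)) => //.
      by rewrite normrX normrN1 expr1n.
    rewrite -mulrBr normrM ger0_norm ?pi_ge0// mulrCA ler_pM2l ?pi_gt0// => kk.
    have [ck|kc] := leP c `|k e x|%R.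
      by rewrite indicE mem_set//= lerDl.
    have ck' : (c <= `|k (flip j e) x|)%R.
      by have := ler_normB (k e x) (k (flip j e) x); lra.
    by rewrite addrC indicE mem_set//= lerDl.
  (* Since [flip j] permutes the patterns, summing over [e] or over [flip j e] gives the same
     total. *)
  have -> : (2 * \sum_e (\1_(A e) x : R) = \sum_e (\1_(A e) x + (\1_(A (flip j e)) x : R)))%R.
    rewrite big_split/= mulr2n mulrDl mul1r; congr (_ + _)%R.
    by rewrite (reindex_inj (inv_inj (flipK j))).
  rewrite -sum1_card natr_sum; apply: ler_sum => e _; exact: pair.
- by move=> e; rewrite leNgt; apply/negP => te; apply: allA; exists e.
Qed.

End key.

(** * Pointwise bounds and divergence for the kernel 1/(x - y) *)

Section cauchy_bounds.
Context (R : realType).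
Local Notation mu := (@lebesgue_measure R).

(** Seen from a point outside [[a, b]], the kernel has constant sign on the interval and absolute
    value at least [1 / K]. A truncation below the distance to the interval removes nothing. *)
Lemma truncated_cauchy_ge_itv (phi : R -> R) (a b x K m : R) :
  measurable_fun setT phi -> (forall y, 0 <= phi y) -> 0 < K ->
  (forall y, a <= y <= b -> `|x - y| <= K) -> ~~ (a <= x <= b) -> a <= b ->
  (m%:E <= \int[mu]_(y in `[a, b]) (phi y)%:E)%E ->
  truncated_cauchy_ge (fun y => phi y * \1_(`[a, b]%classic) y) x (m / K).
Proof.
move=> mphi phi0 K0 xK xab ab mle.
set h := fun y => phi y * \1_(`[a, b]%classic) y.
(* [s] is the sign of [x - y] on the interval and [e0] the distance from [x] to it. *)
have [s [e0 [e00 s1 sE]]] : exists s e0 : R, [/\ 0 < e0, `|s| = 1 &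
    forall y, a <= y <= b -> e0 <= `|x - y| /\ s / (x - y) = `|x - y|^-1].
  move: xab; rewrite negb_and -!ltNge => /orP[xa|bx].
    exists (-1), (a - x); split; rewrite ?subr_gt0 ?normrN1// => y /andP[ay yb].
    have xy : x - y <= 0 by lra.
    by rewrite ler0_norm// mulN1r invrN; split=> //; lra.
  exists 1, (x - b); split; rewrite ?subr_gt0 ?normr1// => y /andP[ay yb].
  have xy : 0 <= x - y by lra.
  by rewrite ger0_norm// mul1r; split=> //; lra.
exists e0 => // e /andP[e_gt0 ee0] Ih.
set D := [set y | e < `|x - y|] in Ih *.
have mD : measurable D by exact: measurable_trunc.
have QD : `[a, b]%classic `<=` D.
  by move=> y /=; rewrite in_itv/= => /sE[+ _]; exact: lt_le_trans.
have Ish : mu.-integrable D (fun y => (s%:E * (h y / (x - y))%:E)%E) by exact: integrableZl.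
have hs_ge0 y : 0 <= s * (h y / (x - y)).
  rewrite /h indicE; have [yab|] := boolP (y \in _); last by rewrite mulr0 mul0r mulr0.
  have yab' : a <= y <= b by move: yab; rewrite inE/= in_itv.
  rewrite mulr1 mulrCA; apply: mulr_ge0 => //.
  have [_ xy] := sE _ yab'.
  by rewrite xy invr_ge0.
have lower : ((m / K)%:E <= \int[mu]_(y in D) (s%:E * (h y / (x - y))%:E))%E.
  apply: (@le_trans _ _ (\int[mu]_(y in `[a, b]) (K^-1%:E * (phi y)%:E))%E).
    rewrite ge0_integralZl_EFin//; last 3 first.
    - by move=> y _; rewrite lee_fin.
    - by apply: measurable_funTS; exact/measurable_EFinP.
    - by rewrite invr_ge0 ltW.
    by rewrite mulrC EFinM; apply: lee_wpmul2l => //; rewrite lee_fin invr_ge0 ltW.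
  apply: (@le_trans _ _ (\int[mu]_(y in `[a, b]) (s%:E * (h y / (x - y))%:E))%E).
    apply: nneg_le_integral => y /=; rewrite in_itv/= => yab.
    have [e0y xy] := sE _ yab.
    rewrite -!EFinM !lee_fin mulr_ge0 ?invr_ge0 ?(ltW K0)//=.
    rewrite /h indicE mem_set ?mulr1/=; last by rewrite in_itv.
    have xy0 : 0 < `|x - y| by exact: lt_le_trans e0y.
    rewrite [s * _]mulrCA xy.
    rewrite mulrC; apply: ler_wpM2l => //; rewrite lef_pV2 ?posrE//; exact: xK.
  apply: ge0_subset_integral => //.
  - by have /measurable_int := Ish.
  - by move=> y _; rewrite -EFinM lee_fin.
(* Finiteness is needed before removing [fine], which would send an infinite value to 0. *)
have Ifin : (\int[mu]_(y in D) (h y / (x - y))%:E)%E \is a fin_num by exact: integrable_fin_num.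
move: lower; rewrite integralZl// -[X in (_ * X)%E]fineK// -EFinM lee_fin => /le_trans; apply.
by apply: le_trans (ler_norm _) _; rewrite normrM s1 mul1r.
Qed.

(** By disjointness at most one term of the sum is nonzero at any point. *)
Lemma signed_sum_itv_le (n : nat) (phi : R -> R) (Q : 'I_n -> set R)
    (e : {ffun 'I_n -> bool}) x :
  (forall y, 0 <= phi y) -> (forall i j y, Q i y -> Q j y -> i = j) ->
  `|signed_sum (fun i y => phi y * \1_(Q i) y) e x|
    <= phi x * \1_(\bigcup_i Q i) x.
Proof.
move=> phi0 QQ; rewrite /signed_sum.
have [[j Qj]|nQ] := pselect (exists j, Q j x).
  rewrite (bigD1 j)//= big1 ?addr0; last first.
    move=> i ij; rewrite indicE memNset ?mulr0// => Qi.
    by move: ij; rewrite (QQ _ _ _ Qi Qj) eqxx.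
  rewrite normrM normrX normrN1 expr1n mul1r ger0_norm ?mulr_ge0//.
  by rewrite !indicE !mem_set//; exists j.
rewrite big1 ?normr0 ?mulr_ge0// => i _.
by rewrite indicE memNset ?mulr0// => Qi; apply: nQ; exists i.
Qed.

(** Each dyadic block from [x + e * 2 ^+ n] to [x + e * 2 ^+ n.+1] has length [e * 2 ^+ n], and the
    integrand there is at least the inverse of twice this length. Every block contributes at least
    1/2. *)
Lemma dyadic_inv_integral_ge (x e : R) (n : nat) : 0 < e ->
  measurable_fun [set y | e < `|x - y|] (fun y => (`|1 / (x - y)|%R)%:E) ->
  ((n%:R / 2)%:E <= \int[mu]_(y in `](x + e)%R, (x + e * 2 ^+ n)%R]) (`|1 / (x - y)|%R)%:E)%E.
Proof.
move=> e0 mfD.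
have mf (D : set R) : D `<=` `]x + e, +oo[ -> measurable_fun D (fun y : R => (`|1 / (x - y)|%R)%:E).
  move=> Dx; apply: measurable_funS mfD; first exact: measurable_trunc.
  by move=> y /Dx /=; rewrite in_itv/= andbT distrC => xy; rewrite ger0_norm; lra.
elim: n => [|n IHn]; first by rewrite mul0r integral_ge0// => y _; rewrite lee_fin.
have p1 : 1 <= 2 ^+ n :> R by rewrite exprn_ege1// ler1n.
have ep : e <= e * 2 ^+ n by rewrite ler_peMr// ltW.
rewrite exprS (_ : `]x + e, x + e * (2 * 2 ^+ n)]%classic =
    `]x + e, x + e * 2 ^+ n]%classic `|` `]x + e * 2 ^+ n, x + e * (2 * 2 ^+ n)]%classic); last first.
  apply/seteqP; split=> y /=; rewrite !in_itv/=.
    move=> /andP[-> ->]; rewrite !andbT/=.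
    by case: (leP y (x + e * 2 ^+ n)) => _; [left|right].
  move=> [|]/andP[y1 y2]; apply/andP; split; lra.
rewrite ge0_integral_setU//; last 2 first.
- by apply: mf => y [] /=; rewrite !in_itv/= => /andP[y1 _]; rewrite andbT; lra.
- apply/disj_setPS => y [] /=; rewrite !in_itv/= => /andP[_ y1] /andP[y2 _]; lra.
rewrite -natr1 mulrDl EFinD; apply: leeD => //.
set E := `]x + e * 2 ^+ n, x + e * (2 * 2 ^+ n)]%classic.
apply: (@le_trans _ _ (\int[mu]_(y in E) (cst ((e * (2 * 2 ^+ n))^-1)%:E y))%E).
  have -> : (\int[mu]_(y in E) (cst ((e * (2 * 2 ^+ n))^-1)%:E y) =
      ((e * (2 * 2 ^+ n))^-1)%:E * mu E)%E.
    by rewrite integral_cst//; exact: measurable_itv.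
  have -> : mu E = (e * 2 ^+ n)%:E.
    rewrite /E lebesgue_measure_itv/= lte_fin ifT; last by lra.
    by rewrite -EFinD; congr (_%:E); ring.
  have q0 : e * 2 ^+ n != 0 by rewrite mulf_neq0 ?gt_eqF// (lt_le_trans _ p1).
  by rewrite -EFinM lee_fin [e * (2 * _)]mulrCA invfM mulfVK// mul1r.
apply: nneg_le_integral => y; rewrite /E/= in_itv/= => /andP[y1 y2].
have d0 : 0 < y - x by lra.
rewrite !lee_fin invr_ge0 mul1r normfV distrC ger0_norm ?(ltW d0)//.
by apply/andP; split; [lra|rewrite lef_pV2 ?posrE//; lra].
Qed.

Lemma not_integrable_inv (x e : R) : 0 < e ->
  ~ mu.-integrable [set y | e < `|x - y|] (fun y => (1 / (x - y))%:E).
Proof.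
move=> e0 /integrableP[mf]; set I := integral _ _ _ => Ioo.
have mf' : measurable_fun [set y | e < `|x - y|] (fun y => (`|1 / (x - y)|%R)%:E).
  exact: (measurableT_comp (@abse_measurable R setT) mf).
have I0 : (0 <= I)%E by apply: integral_ge0.
have Ifin : I \is a fin_num by rewrite ge0_fin_numE.
(* The number of blocks exceeds [2 * fine I], so they already contribute more than the whole
   integral. *)
have := dyadic_inv_integral_ge (Num.bound (2 * fine I)) e0 mf'.
apply/negP; rewrite -ltNge; apply: (@le_lt_trans _ _ I).
  apply: ge0_subset_integral => //.
  - exact: measurable_trunc.
  - by move=> y /=; rewrite in_itv/= => /andP[y1 _]; rewrite distrC ger0_norm; lra.
rewrite -(fineK Ifin) lte_fin ltr_pdivlMr// mulrC.
by apply: archi_boundP; rewrite mulr_ge0// fine_ge0.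
Qed.

End cauchy_bounds.

(** * Indicators of intervals and doubling of [V] *)

Lemma measure_subU (d : measure_display) (T : measurableType d) (R : realType)
    (m : {measure set T -> \bar R}) (X A B : set T) :
  measurable X -> measurable A -> measurable B -> X `<=` A `|` B ->
  (m X <= m A + m B)%E.
Proof.
move=> mX mA mB XAB; apply: le_trans (measureU2 m mA mB).
by apply: le_measure; rewrite ?inE//; exact: measurableU.
Qed.

(** Continuity from below: if every [m (F n)] were at most [t], so would be the measure of the
    union. *)
Lemma measure_bigcup_gt (d : measure_display) (T : measurableType d) (R : realType)
    (m : {measure set T -> \bar R}) (F : (set T)^nat) (t : \bar R) :
  (forall i, measurable (F i)) -> nondecreasing_seq F ->
  (t < m (\bigcup_n F n))%E -> exists n, (t < m (F n))%E.
Proof.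
move=> mF ndF tF; apply: contrapT => /forallNP nt.
have mU : measurable (\bigcup_n F n) by exact: bigcup_measurable.
have cF := nondecreasing_cvg_mu (mu := m) mF mU ndF.
move: tF; apply/negP; rewrite -leNgt -(cvg_lim _ cF)//.
apply: lime_le; first by apply/cvg_ex; eexists; exact: cF.
by apply: nearW => n /=; rewrite leNgt; apply/negP; exact: nt.
Qed.

Section doubling.
Local Open Scope ereal_scope.
Context (R : realType) (p : R) (u w : R -> R) (C : R).
Hypotheses (p0 : (0 < p)%R) (wu : weightR u) (ww : weightRplus w) (C0 : (0 <= C)%R).
Hypothesis Hbd : forall f : R -> R, in_lorentz p u w f ->
  exists Hf : R -> R, measurable_fun setT Hf /\ is_hilbert f Hf /\
    weak_lorentz_norm p u w (fun x => (Hf x)%:E)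
      <= C%:E * lorentz_norm p u w (fun x => (f x)%:E).
Local Notation mu := (@lebesgue_measure R).
Local Notation nu := (absdens (weightR_measurable wu)).
Local Notation V t := (poweR (Wfun w t) p^-1).

Lemma in_lorentz_indic (E : set R) : measurable E -> nu E < +oo ->
  in_lorentz p u w (\1_E : R -> R).
Proof.
move=> mE Efin; split; first exact: measurable_indic.
rewrite (lorentz_norm_indic p0 ww mE Efin).
by apply: poweR_lty; exact: Wfun_lty.
Qed.

Lemma le_V s t : (s <= t)%R -> V s <= V t.
Proof.
move=> st; apply: ge0_le_poweR; first by rewrite invr_ge0 ltW.
  exact: Wfun_ge0.
exact: le_Wfun.
Qed.

(** The sign argument for the pieces of [phi] on disjoint intervals. A mass [pi * c * K i] seen
    within distance [K i] yields a truncated Cauchy integral of size [pi * c]. *)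
Lemma signs_itv_weak_type (n : nat) (a b K : 'I_n -> R) (phi F : R -> R) (G : set R) (c t : R) :
  measurable_fun setT phi -> (forall y, (0 <= phi y)%R) ->
  (forall i, (a i <= b i)%R) -> (forall i, (0 < K i)%R) ->
  (forall i j y, (a i <= y <= b i)%R -> (a j <= y <= b j)%R -> i = j) ->
  (forall i, (pi * c * K i)%:E <= \int[mu]_(y in `[a i, b i]) (phi y)%:E) ->
  in_lorentz p u w F ->
  (forall i x, (a i <= x <= b i)%R -> (phi x <= `|F x|)%R) ->
  measurable G ->
  (forall x, G x -> exists2 i, ~~ (a i <= x <= b i)%R &
    forall y, (a i <= y <= b i)%R -> (`|x - y| <= K i)%R) ->
  (0 < t)%R -> (2 * t)%:E < nu G ->
  c%:E * V t <= C%:E * lorentz_norm p u w (fun x => (F x)%:E).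
Proof.
move=> mphi phi0 ab K0 disj phiI LF phiF mG GK t0 tG.
apply: (@signs_weak_type R p u w C p0 wu ww C0 Hbd n
  (fun i y => (phi y * \1_(`[a i, b i]%classic) y)%R) F G c t) => //.
- by move=> i; apply: measurable_funM.
- move=> e x; apply: le_trans (signed_sum_itv_le e x _ _) _ => //.
  rewrite indicE; have [|_] := boolP (x \in _); last by rewrite mulr0.
  by rewrite inE => -[i _ /=]; rewrite in_itv/= mulr1; exact: phiF.
- move=> x /GK[i xi xK]; exists i.
  rewrite -[(pi * c)%R](@mulfK _ (K i)); last by rewrite gt_eqF.
  exact: truncated_cauchy_ge_itv.
Qed.

(* Otherwise the constant 1 is in the space, but its Hilbert transform diverges. *)
Lemma umeas_setT : nu setT = +oo.
Proof.
apply/eqP; rewrite eq_le leey/= leNgt; apply/negP => finu.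
have [Hf [_ [[N [mN N0 sN]] _]]] := Hbd (in_lorentz_indic measurableT finu).
have [x Nx] : exists x, ~ N x.
  apply: contrapT => /forallNP NT.
  have : mu setT = 0.
    by rewrite -N0; congr (mu _); apply/seteqP; split => // x _; apply: contrapT; exact: NT.
  rewrite -set_itvNyy lebesgue_measure_itv/=; discriminate.
have [pvi _] : pv_cauchy (\1_setT : R -> R) x (pi * Hf x)%R.
  by apply: contrapT => pvx; apply: Nx; exact: sN.
have /filter_ex[e [e0 Ie]] : \forall e \near (0%R : R)^'+, (0 < e)%R /\
    mu.-integrable [set y | (e < `|x - y|)%R] (fun y => (\1_setT y / (x - y))%:E).
  by near=> e; split; near: e => //; exact: nbhs_right_gt.
apply: (@not_integrable_inv R x e e0); apply: eq_integrable Ie => //.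
  exact: measurable_trunc.
by move=> y _; rewrite indicE in_setT.
Unshelve. all: by end_near. Qed.

(** Infinite total mass provides some [[-n, n]] of mass above [t]. The mass of [[-n, c]] depends
    continuously on [c] and vanishes at the left endpoint, so it takes the value [t]. *)
Lemma umeas_itv_ivt (t : R) : (0 < t)%R ->
  exists a b : R, (a < b)%R /\ nu `[a, b] = t%:E.
Proof.
move=> t0.
have [n tn] : exists n, t%:E < nu `[(- n%:R)%R, n%:R].
  apply: measure_bigcup_gt => //.
    move=> m k mk; apply/subsetPset => x /=; rewrite !in_itv/= => /andP[mx xm].
    have mk' : (m%:R <= k%:R :> R)%R by rewrite ler_nat.
    by apply/andP; split; lra.
  by rewrite (bigcup_itvT true false) [X in _ < X]umeas_setT ltry.
set a : R := (- n%:R)%R in tn *; set b : R := n%:R in tn *.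
have ab : (a <= b)%R by rewrite /a /b; have : (0 <= n%:R :> R)%R by []; lra.
have Iu : mu.-integrable `[a, b] (EFin \o (fun x => `|u x|%R)).
  have [Iu _] := wu; have := integrable_abse (Iu a b).
  exact: eq_integrable.
have cF := parameterized_integral_continuous ab Iu.
have FE c : parameterized_integral mu a c (fun x => `|u x|%R) = fine (nu `[a, c]) by [].
have nufin c : nu `[a, c] \is a fin_num.
  by rewrite ge0_fin_numE//; exact: umeas_itv_lty.
have nua : nu `[a, a] = 0 by rewrite set_itv1; exact: integral_set1.
have := IVT ab cF; rewrite /= !FE nua/= => /(_ t) [].
  have tb : (t < fine (nu `[a, b]))%R by rewrite -lte_fin fineK.
  by rewrite ge_min le_max (ltW t0) (ltW tb) orbT.
move=> c; rewrite in_itv/= => /andP[ac cb]; rewrite FE => Fc; exists a, c; split.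
  rewrite lt_neqAle ac andbT; apply/eqP => ac'.
  by move: Fc; rewrite -ac' nua/= => t0'; move: t0; rewrite -t0' ltxx.
by rewrite -Fc fineK.
Qed.

(** The outer thirds are disjoint, so the lighter one carries at most half of the mass. *)
Lemma umeas_third (a b : R) : (a < b)%R ->
  exists a' b' : R, [/\ (a <= a')%R, (b' <= b)%R, (b' - a' = (b - a) / 3)%R &
    (2 * fine (nu `[a', b']) <= fine (nu `[a, b]))%R].
Proof.
move=> ab; set d := ((b - a) / 3)%R.
have d0 : (0 < d)%R by rewrite /d divr_gt0// subr_gt0.
have dE : (b - a = 3 * d)%R by rewrite /d mulrC divfK.
have sum : nu `[a, (a + d)%R] + nu `[(b - d)%R, b] <= nu `[a, b].
  rewrite -measureU//; last first.
    by rewrite -subset0 => y [] /=; rewrite !in_itv/= => /andP[_ y1] /andP[y2 _]; lra.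
  apply: le_measure; rewrite ?inE//; first exact: measurableU.
  by move=> y [] /=; rewrite !in_itv/= => /andP[y1 y2]; apply/andP; split; lra.
have nufin r s : nu `[r, s] \is a fin_num by rewrite ge0_fin_numE//; exact: umeas_itv_lty.
move: sum; rewrite -[nu `[a, (a + d)%R]]fineK// -[nu `[(b - d)%R, b]]fineK//.
rewrite -[nu `[a, b]]fineK// -EFinD lee_fin => sum.
have [le12|/ltW le12] := leP (fine (nu `[a, (a + d)%R])) (fine (nu `[(b - d)%R, b])).
  by exists a, (a + d)%R; split => //; lra.
by exists (b - d)%R, b; split => //; lra.
Qed.

Lemma V_doubling (t : R) : (0 < t)%R -> V (2 * t) <= (27 * pi * C)%:E * V t.
Proof.
move=> t0.
(* Three passages to a light third divide the mass by at least 8 and the length by exactly 27. *)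
have t8 : (0 < 8 * t)%R by lra.
have [a [b [ab nuab]]] := umeas_itv_ivt t8.
have [a1 [b1 [aa1 bb1 d1 n1]]] := umeas_third ab.
have ab1 : (a1 < b1)%R by lra.
have [a2 [b2 [aa2 bb2 d2 n2]]] := umeas_third ab1.
have ab2 : (a2 < b2)%R by lra.
have [a3 [b3 [aa3 bb3 d3 n3]]] := umeas_third ab2.
have ab3 : (a3 < b3)%R by lra.
set Q := `[a3, b3]%classic.
have Qfin : nu Q \is a fin_num by rewrite ge0_fin_numE//; exact: umeas_itv_lty.
have Qt : (fine (nu Q) <= t)%R by move: n1; rewrite nuab/= /Q; lra.
set G := `[a, b]%classic `\` Q.
have mG : measurable G by apply: measurableD; exact: measurable_itv.
have QG : (4 * t)%:E < nu G.
  rewrite ltNge; apply/negP => Gt.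
  have : nu `[a, b] <= nu G + nu Q.
    apply: measure_subU => //; [exact: measurable_itv..|].
    by move=> x abx; have [|] := pselect (Q x); [right|left].
  rewrite nuab -[nu Q]fineK//; apply/negP; rewrite -ltNge.
  apply: (@le_lt_trans _ _ ((4 * t)%:E + t%:E)); last by rewrite -EFinD lte_fin; lra.
  by apply: leeD => //; rewrite lee_fin.
(* This makes [pi * c * (b - a)] equal to the length of [Q], with [b - a] bounding distances inside
   the large interval. *)
pose c : R := ((27 * pi)^-1)%R.
have pi0 : (0 < pi :> R)%R by exact: pi_gt0.
have c0 : (0 < c)%R by rewrite invr_gt0 mulr_gt0.
have key : c%:E * V (2 * t) <= C%:E * lorentz_norm p u w (fun x => (\1_Q x : R)%:E).
  apply: (@signs_itv_weak_type 1 (fun=> a3) (fun=> b3) (fun=> (b - a)%R) (cst 1%R) _ G) => //.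
  - by move=> _; exact: ltW.
  - by move=> _; rewrite subr_gt0.
  - by move=> i j y _ _; rewrite !ord1.
  - move=> _; have -> : \int[mu]_(y in `[a3, b3]) (cst 1%R y)%:E = 1 * mu `[a3, b3].
      by rewrite -integral_cst//; exact: measurable_itv.
    rewrite mul1e lebesgue_measure_itv/= lte_fin ab3 -EFinD lee_fin.
    have -> : (pi * c = 27^-1)%R by rewrite /c invfM mulrCA mulfV ?gt_eqF// mulr1.
    by lra.
  - by apply: in_lorentz_indic; [exact: measurable_itv|exact: umeas_itv_lty].
  - by move=> _ x x3; rewrite indicE mem_set ?normr1//= in_itv.
  - move=> x [/= abx Qx]; exists ord0; first by apply/negP => x3; apply: Qx; rewrite /Q/= in_itv.
    by move: abx; rewrite in_itv/= => abx y y3; rewrite ler_norml; lra.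
  - by lra.
  - by apply: le_lt_trans QG; rewrite lee_fin; lra.
rewrite (lorentz_norm_indic p0 ww _ _) in key; last 2 first.
- exact: measurable_itv.
- exact: umeas_itv_lty.
have {}key : c%:E * V (2 * t) <= C%:E * V t.
  apply: (le_trans key); apply: lee_wpmul2l; first by rewrite lee_fin.
  exact: le_V.
have -> : (27 * pi * C)%:E * V t = (27 * pi)%:E * (C%:E * V t) by rewrite EFinM muleA.
have -> : V (2 * t) = (27 * pi)%:E * (c%:E * V (2 * t)).
  by rewrite muleA -EFinM /c mulfV ?mul1e// mulf_neq0// gt_eqF.
by apply: lee_wpmul2l => //; rewrite lee_fin mulr_ge0// ltW.
Qed.

(** Two doublings: one pays for splitting the cover of the level set into two parts, the other for
    the factor 2 lost in averaging over signs. *)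
Lemma V_le_quarter (t : R) : (0 < t)%R -> V t <= ((27 * pi * C) ^+ 2)%:E * V (t / 4).
Proof.
move=> t0.
have D0 : (0 <= 27 * pi * C)%R by rewrite !mulr_ge0// pi_ge0.
have tE : (t = 2 * (2 * (t / 4)))%R by lra.
rewrite [X in V X]tE.
have t4 : (0 < t / 4)%R by lra.
have t2 : (0 < 2 * (t / 4))%R by lra.
move: D0 (V_doubling t2) (V_doubling t4); move: (27 * pi * C)%R => D D0 V2 V4.
by apply: le_trans V2 _; rewrite expr2 EFinM -muleA; apply: lee_wpmul2l; rewrite ?lee_fin.
Qed.

End doubling.

(** * Vitali covering by finitely many intervals *)

Definition itv_apart (R : realType) (I J : R * R) : bool := (I.2 < J.1) || (J.2 < I.1).

Lemma exists_longest (R : realType) (I : R * R) (s : seq (R * R)) :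
  exists2 J, J \in I :: s & forall K, K \in I :: s -> K.2 - K.1 <= J.2 - J.1.
Proof.
elim: s I => [|I' s IHs] I.
  by exists I; rewrite ?mem_head// => K; rewrite inE => /eqP ->.
have [J Js Jmax] := IHs I'.
have [IJ|/ltW JI] := leP (I.2 - I.1) (J.2 - J.1).
  exists J; first by rewrite inE Js orbT.
  by move=> K; rewrite inE => /predU1P[->//|]; exact: Jmax.
exists I; first by rewrite mem_head.
by move=> K; rewrite inE => /predU1P[->//|/Jmax KJ]; exact: le_trans JI.
Qed.

(** Greedy selection: keep a longest interval [J] and discard all those meeting it. They are no
    longer than [J], so they lie in its triple; then recurse on the rest. *)
Lemma vitali_itv (R : realType) (s : seq (R * R)) :
  (forall I, I \in s -> I.1 <= I.2) ->
  exists D : seq (R * R), [/\ {subset D <= s}, pairwise (@itv_apart R) D &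
    forall I x, I \in s -> I.1 <= x <= I.2 ->
      exists2 J, J \in D & J.1 - (J.2 - J.1) <= x <= J.2 + (J.2 - J.1)].
Proof.
have [n sn] : exists n, (size s <= n)%N by exists (size s).
elim: n s sn => [|n IHn] [|I0 s] // sn sle.
- by exists [::]; split.
- by exists [::]; split.
have [J Js Jmax] := exists_longest I0 s.
(* [J] meets itself, so the filtered list is strictly shorter. *)
have szs' : (size [seq I <- I0 :: s | itv_apart J I] <= n)%N.
  rewrite -ltnS; apply: leq_trans sn; rewrite size_filter ltn_neqAle count_size andbT.
  rewrite -all_count; apply/allPn; exists J => //.
  by rewrite /itv_apart orbb -leNgt; exact: sle.
have [I|D [Ds Dpw Dcov]] := IHn _ szs'; first by rewrite mem_filter => /andP[_]; exact: sle.
exists (J :: D); split.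
- move=> I; rewrite inE => /predU1P[->//|/Ds]; by rewrite mem_filter => /andP[].
- rewrite /= Dpw andbT; apply/allP => I /Ds; by rewrite mem_filter => /andP[].
move=> I x Is Ix; have [JI|nJI] := boolP (itv_apart J I).
  have [|K KD Kx] := Dcov I x _ Ix; first by rewrite mem_filter JI.
  by exists K => //; rewrite inE KD orbT.
exists J; first by rewrite mem_head.
move: nJI; rewrite /itv_apart negb_or -!leNgt => /andP[IJ2 JI2].
have := Jmax _ Is; lra.
Qed.

(** * Level sets of the maximal function *)

Section maximal_cover.
Local Open Scope ereal_scope.
Context (R : realType) (f : R -> R) (l : R).
Hypotheses (mf : measurable_fun setT f) (l0 : (0 < l)%R).
Local Notation mu := (@lebesgue_measure R).

(** Here [absdens mf] is the measure with density [|f|]; the average condition is cleared of its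
    denominator. *)
Definition heavy (a b : R) : Prop :=
  (a < b)%R /\ (l * (b - a))%:E < absdens mf `[a, b].

Lemma maximal_gtP x : l%:E < maximal f x <-> exists a b, heavy a b /\ (a <= x <= b)%R.
Proof.
split=> [/ereal_sup_gt[_ [[a b] /= [ab abx] <-] lt]|[a [b [[ab lab] abx]]]].
  exists a, b; split => //; split => //.
  rewrite mulrC EFinM -lte_pdivlMl ?subr_gt0//.
apply: (@lt_le_trans _ _ ((b - a)^-1%:E * absdens mf `[a, b])).
  by rewrite lte_pdivlMl ?subr_gt0// -EFinM mulrC.
by apply: ereal_sup_ubound; exists (a, b).
Qed.

(** The strict inequality leaves room to enlarge the interval slightly to rational endpoints, since
    enlarging does not decrease its mass. *)
Lemma heavy_rat a b : heavy a b ->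
  exists q r : rat, [/\ heavy (ratr q) (ratr r), (ratr q < a)%R & (b < ratr r)%R].
Proof.
move=> [ab lab].
(* The mass may be infinite, so the slack is measured by a real [z] below it. *)
have [z lz zI] : exists2 z : R, (l * (b - a) < z)%R & z%:E <= absdens mf `[a, b].
  move: lab; case: (absdens mf `[a, b]) => [y| |//].
    by rewrite lte_fin => ly; exists y.
  by move=> _; exists (l * (b - a) + 1)%R; rewrite ?ltrDl ?leey.
(* Enlarging by at most [d] on each side raises [l] times the length by at most [2 * l * d], two
   thirds of the available slack. *)
pose d := ((z - l * (b - a)) / (3 * l))%R.
have d0 : (0 < d)%R by rewrite divr_gt0 ?subr_gt0 ?mulr_gt0.
have dE : (3 * (l * d) = z - l * (b - a))%R.
  by rewrite mulrA mulrC /d divfK// gt_eqF ?mulr_gt0.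
have ad : (a - d < a)%R by lra.
have bd : (b < b + d)%R by lra.
have [q] := rat_in_itvoo ad; rewrite in_itv/= => /andP[q1 q2].
have [r] := rat_in_itvoo bd; rewrite in_itv/= => /andP[r1 r2].
exists q, r; split => //; split; first by lra.
apply: (@lt_le_trans _ _ z%:E).
  rewrite lte_fin; apply: (@le_lt_trans _ _ (l * (b - a + 2 * d))%R).
    by apply: ler_wpM2l; [exact: ltW|lra].
  have ld : (0 < l * d)%R by exact: mulr_gt0.
  by rewrite mulrDr mulrCA; lra.
apply: (le_trans zI); apply: le_measure; rewrite ?inE//.
by move=> y /=; rewrite !in_itv/= => /andP[ay yb]; apply/andP; split; lra.
Qed.

(** Enumerating rational pairs turns the level set into a countable union of open intervals, which
    gives its measurability and its exhaustion by finite unions. *)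
Definition heavy_enum (k : nat) : set R :=
  if @unpickle (rat * rat)%type k is Some qr then
    [set x | heavy (ratr qr.1) (ratr qr.2) /\ (ratr qr.1 < x < ratr qr.2)%R]
  else set0.

Lemma measurable_heavy_enum k : measurable (heavy_enum k).
Proof.
rewrite /heavy_enum; case: unpickle => [[q r]|//] /=.
have [h|nh] := pselect (heavy (ratr q) (ratr r)).
  rewrite (_ : [set x | _] = `](ratr q), (ratr r)[%classic); first exact: measurable_itv.
  by apply/seteqP; split=> x /=; rewrite in_itv/=; [case|].
rewrite (_ : [set x | _] = set0)//.
by rewrite -subset0 => x [].
Qed.

Lemma maximal_gtE : [set x | l%:E < maximal f x] = \bigcup_k heavy_enum k.
Proof.
apply/seteqP; split=> x /=.
  move=> /maximal_gtP[a [b [/heavy_rat[q [r [h qa br]]] /andP[ax xb]]]].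
  exists (pickle (q, r)); first by [].
  rewrite /heavy_enum pickleK; split; first exact: h.
  by apply/andP; split=> /=; lra.
move=> [k _]; rewrite /heavy_enum; case: unpickle => [[q r]|//] /= [h /andP[qx xr]].
by apply/maximal_gtP; exists (ratr q), (ratr r); split=> //; rewrite !ltW.
Qed.

Lemma measurable_maximal_gt : measurable [set x | l%:E < maximal f x].
Proof. by rewrite maximal_gtE; apply: bigcup_measurable => k _; exact: measurable_heavy_enum. Qed.

Lemma heavy_enum_finite n : exists2 s : seq (R * R),
  (forall I, I \in s -> heavy I.1 I.2) &
  (\big[setU/set0]_(k < n) heavy_enum k `<=` [set x | exists2 I, I \in s & (I.1 <= x <= I.2)%R]).
Proof.
elim: n => [|n [s sh scov]]; first by exists [::]; rewrite // big_ord0.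
rewrite big_ord_recr/= {2}/heavy_enum.
case: unpickle => [[q r]|] /=; last by exists s; rewrite // setU0.
have [h|nh] := pselect (heavy (ratr q) (ratr r)).
  exists ((ratr q, ratr r) :: s) => [I|x].
    by rewrite inE => /predU1P[->//|]; exact: sh.
  case=> [/scov[I Is Ix]|[_ /andP[qx xr]]].
    by exists I; rewrite ?inE ?Is ?orbT.
  by exists (ratr q, ratr r); rewrite ?mem_head// !ltW.
by exists s => // x [/scov//|[]].
Qed.

(** One of the two halves carries at least half of the mass; the outermost quarter on the opposite
    side is at positive distance from it. *)
Lemma heavy_half a b : heavy a b -> exists h1 h2 o1 o2 : R,
  [/\ (a <= h1 <= h2)%R && (h2 <= b)%R, (a <= o1)%R && (o2 <= b)%R,
      (o2 - o1 = (b - a) / 4)%R, (h2 < o1)%R \/ (o2 < h1)%R &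
      (l * (b - a) / 2)%:E <= absdens mf `[h1, h2]].
Proof.
move=> [ab lab]; pose m := ((a + b) / 2)%R; pose q := ((b - a) / 4)%R.
have mE : (m = a + 2 * q)%R by rewrite /m /q; lra.
have bE : (b = a + 4 * q)%R by rewrite /q; lra.
have q0 : (0 < q)%R by lra.
have sub : absdens mf `[a, b] <= absdens mf `[a, m] + absdens mf `[m, b].
  apply: measure_subU; [exact: measurable_itv..|].
  move=> x /=; rewrite !in_itv/= => /andP[ax xb].
  by have [xm|/ltW mx] := leP x m; [left|right]; apply/andP; split.
have [le1|lt1] := leP (l * (b - a) / 2)%:E (absdens mf `[a, m]).
  by exists a, m, (b - q)%R, b; split => //; [lra|lra|lra|left; lra].
have [le2|lt2] := leP (l * (b - a) / 2)%:E (absdens mf `[m, b]).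
  by exists m, b, a, (a + q)%R; split => //; [lra|lra|lra|right; lra].
exfalso; move: lab; apply/negP; rewrite -leNgt; apply: (le_trans sub).
apply: (@le_trans _ _ ((l * (b - a) / 2)%:E + (l * (b - a) / 2)%:E)).
  by apply: leeD; exact: ltW.
by rewrite -EFinD lee_fin; lra.
Qed.

End maximal_cover.

Lemma maximal_ge0 (R : realType) (f : R -> R) x : (0 <= maximal f x)%E.
Proof.
apply: ereal_sup_ge; exists ((x + 1 - x)^-1%:E *
    \int[lebesgue_measure]_(y in Icc x (x + 1)%R) `|f y|%:E)%E.
  by exists (x, x + 1) => //=; split; lra.
apply: mule_ge0; first by rewrite lee_fin addrAC subrr add0r invr1.
by apply: integral_ge0 => y _; rewrite lee_fin.
Qed.

(** * The weak-type bound for the maximal function *)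

Section maximal_weak_type.
Local Open Scope ereal_scope.
Context (R : realType) (p : R) (u w : R -> R) (C : R).
Hypotheses (p0 : (0 < p)%R) (wu : weightR u) (ww : weightRplus w) (C0 : (0 <= C)%R).
Hypothesis Hbd : forall f : R -> R, in_lorentz p u w f ->
  exists Hf : R -> R, measurable_fun setT Hf /\ is_hilbert f Hf /\
    weak_lorentz_norm p u w (fun x => (Hf x)%:E)
      <= C%:E * lorentz_norm p u w (fun x => (f x)%:E).
Local Notation mu := (@lebesgue_measure R).
Local Notation nu := (absdens (weightR_measurable wu)).
Local Notation V t := (poweR (Wfun w t) p^-1).

Lemma V_le_of_quarter (c t : R) (N : \bar R) : (0 < c)%R -> (0 < t)%R ->
  c%:E * V (t / 4) <= C%:E * N ->
  V t <= ((27 * pi * C) ^+ 2 * C / c)%:E * N.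
Proof.
move=> c0 t0 Vc; have := V_le_quarter p0 wu ww C0 Hbd t0.
move: (27 * pi * C)%R => B /le_trans; apply.
rewrite -mulrA [(B ^+ 2 * (C / c))%:E]EFinM -[X in _ <= X]muleA.
apply: lee_wpmul2l; first by rewrite lee_fin sqr_ge0.
by rewrite [(C / c)%R]mulrC EFinM -muleA lee_pdivlMl.
Qed.

(** [A] combines the doubling loss with [C]. The factor [4 * pi] comes from testing on [|f|] over
    the heavy halves and [8 * pi] from testing on the quarters; the sum covers both cases of the
    final dichotomy. *)
Definition maximal_const : R :=
  let A := ((27 * pi * C) ^+ 2 * C)%R in
  (A * (4 * pi) + A * (8 * pi) * (A * (4 * pi)))%R.

Lemma maximal_gt_weak_type (f : R -> R) (l t : R) : in_lorentz p u w f ->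
  (0 < l)%R -> (0 < t)%R -> t%:E < nu [set x | l%:E < maximal f x] ->
  l%:E * V t <= maximal_const%:E * lorentz_norm p u w (fun x => (f x)%:E).
Proof.
move=> Lf l0 t0; have [mf _] := Lf.
rewrite (maximal_gtE mf l0) -bigcup_bigsetU_bigcup => tU.
have [n] : exists n, t%:E < nu (\big[setU/set0]_(k < n.+1) heavy_enum l mf k).
  apply: measure_bigcup_gt tU => [i|i j ij].
    by apply: bigsetU_measurable => k _; exact: measurable_heavy_enum.
  by apply/subsetPset; apply: subset_bigsetU.
have [s sh scov] := heavy_enum_finite l mf n.+1.
set U := \big[setU/set0]_(k < n.+1) _ in scov * => {}tU.
have mU : measurable U by apply: bigsetU_measurable => k _; exact: measurable_heavy_enum.
have [I Is|D [Ds Dpw Dcov]] := @vitali_itv R s; first by have [/ltW] := sh _ Is.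
pose J (i : 'I_(size D)) := nth (0%R, 0%R) D i.
have Jh i : heavy l mf (J i).1 (J i).2 by apply: sh; apply: Ds; exact: mem_nth.
have Jdisj i j y : ((J i).1 <= y <= (J i).2)%R -> ((J j).1 <= y <= (J j).2)%R -> i = j.
  have /(pairwiseP (0%R, 0%R)) apartD := Dpw.
  have lt_apart (k m : 'I_(size D)) : (k < m)%N -> ((J k).1 <= y <= (J k).2)%R -> ~ ((J m).1 <= y <= (J m).2)%R.
    move=> km; have := apartD k m (ltn_ord k) (ltn_ord m) km.
    by rewrite /itv_apart -/(J k) -/(J m) => /orP[]; lra.
  move=> yi yj; case: (ltngtP i j) => [ij|ji|/val_inj//].
    by have := lt_apart _ _ ij yi yj.
  by have := lt_apart _ _ ji yj yi.
have /choice[h1 /choice[h2 /choice[ o1 /choice[ o2 hoP]]]] :=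
  fun i => heavy_half (Jh i).
pose L i := ((J i).2 - (J i).1)%R.
have L0 i : (0 < L i)%R by rewrite subr_gt0; case: (Jh i).
(* The triples from the covering lemma; each of their points is within [2 * L i] of every point of
   [J i]. *)
pose T i := `[((J i).1 - L i)%R, ((J i).2 + L i)%R]%classic.
pose G1 := \bigcup_i (T i `\` `[h1 i, h2 i]%classic).
pose O := \bigcup_i `[o1 i, o2 i]%classic.
pose G2 := \bigcup_i (T i `\` `[o1 i, o2 i]%classic).
have mbig (F : 'I_(size D) -> set R) : (forall i, measurable (F i)) -> measurable (\bigcup_i F i).
  by move=> mF; apply: fin_bigcup_measurable => //; exact: finite_finset.
have mG1 : measurable G1 by apply: mbig => i; apply: measurableD; exact: measurable_itv.
have mG2 : measurable G2 by apply: mbig => i; apply: measurableD; exact: measurable_itv.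
have mO : measurable O by apply: mbig => i; exact: measurable_itv.
have hJ i y : (h1 i <= y <= h2 i)%R -> ((J i).1 <= y <= (J i).2)%R.
  by have [/andP[]] := hoP i; lra.
have oJ i y : (o1 i <= y <= o2 i)%R -> ((J i).1 <= y <= (J i).2)%R.
  by have [_ /andP[]] := hoP i; lra.
have ho i y : (h1 i <= y <= h2 i)%R -> ~ (o1 i <= y <= o2 i)%R.
  by have [_ _ _ []] := hoP i; lra.
have TK i x y : T i x -> ((J i).1 <= y <= (J i).2)%R -> (`|x - y| <= 2 * L i)%R.
  by rewrite /T/= in_itv/= /L => xT yJ; rewrite ler_norml; lra.
have JT i y : ((J i).1 <= y <= (J i).2)%R -> T i y.
  by have := L0 i; rewrite /T/= in_itv/=; lra.
have pi0 : (0 < pi :> R)%R by exact: pi_gt0.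
have N0 : 0 <= lorentz_norm p u w (fun x => (f x)%:E) by exact: poweR_ge0.
pose A : R := ((27 * pi * C) ^+ 2 * C)%R.
have A0 : (0 <= A)%R by rewrite mulr_ge0 ?sqr_ge0.
have bound1 tau : (0 < tau)%R -> (tau / 2)%:E < nu G1 ->
    l%:E * V tau <= (A * (4 * pi))%:E * lorentz_norm p u w (fun x => (f x)%:E).
  move=> tau0 tauG.
  (* A heavy half has mass at least [l * L i / 2], which is [pi * c * (2 * L i)] for
     [c = l / (4 * pi)]. *)
  have c0 : (0 < l / (4 * pi))%R by rewrite divr_gt0 ?mulr_gt0.
  have lE : (A * (4 * pi) = l * (A / (l / (4 * pi))))%R.
    by move: (A) pi0 => B; move: pi => q q0; field; rewrite (gt_eqF l0) (gt_eqF q0).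
  rewrite lE EFinM -muleA; apply: lee_wpmul2l; first by rewrite lee_fin ltW.
  apply: V_le_of_quarter => //.
  apply: (@signs_itv_weak_type R p u w C p0 wu ww C0 Hbd _ h1 h2 (fun i => 2 * L i)%R
    (fun y => `|f y|%R) f G1) => //.
  - exact: measurableT_comp (@normr_measurable R setT) mf.
  - by move=> i; have [/andP[/andP[]]] := hoP i.
  - by move=> i; rewrite mulr_gt0.
  - by move=> i j y /hJ yi /hJ; exact: Jdisj yi.
  - move=> i; have [_ _ _ _] := hoP i; apply: le_trans; rewrite lee_fin.
    have -> : (pi * (l / (4 * pi)) = l / 4)%R.
      by move: pi0; move: pi => q q0; field; rewrite (gt_eqF q0).
    by rewrite /L; nra.
  - move=> x [i _ [Tx hx]]; exists i.
      by apply/negP => xh; apply: hx; rewrite /= in_itv.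
    by move=> y /hJ; exact: TK.
  - by rewrite divr_gt0.
  - by apply: le_lt_trans tauG; rewrite lee_fin; lra.
(* A point of a triple either avoids the heavy half or lies in it and hence avoids the quarter. *)
have cov : U `<=` G1 `|` G2.
  move=> x /scov[I Is Ix]; have [K KD Kx] := Dcov _ _ Is Ix.
  have KDi : (index K D < size D)%N by rewrite index_mem.
  pose i := Ordinal KDi.
  have JK : J i = K by rewrite /J nth_index.
  have Tx : T i x by rewrite /T/= in_itv/= /L JK.
  have [xh|xh] := pselect (h1 i <= x <= h2 i)%R.
    by right; exists i => //; split=> //=; rewrite in_itv/=; exact: ho.
  by left; exists i => //; split=> //=; rewrite in_itv.
have mcE : maximal_const = (A * (4 * pi) + A * (8 * pi) * (A * (4 * pi)))%R by [].
have A4 : (0 <= A * (4 * pi))%R by rewrite mulr_ge0// mulr_ge0// ltW.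
have A8 : (0 <= A * (8 * pi))%R by rewrite mulr_ge0// mulr_ge0// ltW.
have [tG1|G1t] := ltP (t / 2)%:E (nu G1).
  apply: (le_trans (bound1 _ t0 tG1)); apply: lee_wpmul2r => //.
  by rewrite lee_fin mcE lerDl mulr_ge0.
have tG2 : (t / 2)%:E < nu G2.
  rewrite ltNge; apply/negP => G2t.
  have := measure_subU nu mU mG1 mG2 cov; apply/negP; rewrite -ltNge.
  apply: le_lt_trans tU; apply: (@le_trans _ _ ((t / 2)%:E + (t / 2)%:E)).
    exact: leeD.
  by rewrite -EFinD lee_fin; lra.
(* The quarters avoid their heavy halves, so they lie in [G1], whose measure is at most [t / 2] in
   this case. This makes the indicator of [O] a legitimate test function. *)
have OG1 : nu O <= nu G1.
  apply: le_measure; rewrite ?inE// => y [i _ /=]; rewrite in_itv/= => yo.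
  exists i => //; split; first by apply: JT; exact: oJ.
  by rewrite /= in_itv/= => yh; exact: ho yh yo.
have Ofin : nu O < +oo by apply: le_lt_trans OG1 _; exact: le_lt_trans G1t (ltry _).
have On : nu O \is a fin_num by rewrite ge0_fin_numE.
set tau := fine (nu O).
(* The quarter has length [L i / 4], which is [pi * c * (2 * L i)] for [c = 1 / (8 * pi)]. *)
have c0 : (0 < (8 * pi)^-1 :> R)%R by rewrite invr_gt0 mulr_gt0.
have bound2 : V t <= (A * (8 * pi))%:E * V tau.
  rewrite -(lorentz_norm_indic p0 ww mO Ofin) -[(8 * pi)%R]invrK.
  apply: V_le_of_quarter => //.
  apply: (@signs_itv_weak_type R p u w C p0 wu ww C0 Hbd _ o1 o2 (fun i => 2 * L i)%R
    (cst 1%R) (\1_O : R -> R) G2).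
  - exact: measurable_cst.
  - by move=> y; exact: ler01.
  - by move=> i; have [_ _ oL _ _] := hoP i; have := L0 i; rewrite /L; lra.
  - by move=> i; rewrite mulr_gt0.
  - by move=> i j y /oJ yi /oJ; exact: Jdisj yi.
  - move=> i; have [_ _ oL _ _] := hoP i; have Li := L0 i.
    have -> : \int[mu]_(y in `[o1 i, o2 i]) (cst 1%R y)%:E = 1 * mu `[o1 i, o2 i].
      by rewrite -integral_cst//; exact: measurable_itv.
    have oo : (o1 i < o2 i)%R by move: Li; rewrite /L; lra.
    rewrite mul1e lebesgue_measure_itv/= lte_fin oo -EFinD lee_fin oL.
    have -> : (pi * (8 * pi)^-1 = 8^-1 :> R)%R by rewrite invfM mulrCA mulfV ?gt_eqF// mulr1.
    by rewrite /L; lra.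
  - exact: (in_lorentz_indic p0 ww).
  - move=> i x xo; rewrite indicE mem_set ?normr1//=.
    by exists i => //; rewrite /= in_itv.
  - exact: mG2.
  - move=> x [i _ [Tx ox]]; exists i.
      by apply/negP => xo; apply: ox; rewrite /= in_itv.
    by move=> y /oJ; exact: TK.
  - by rewrite divr_gt0.
  - by apply: le_lt_trans tG2; rewrite lee_fin; lra.
have tau_ge0 : (0 <= tau)%R by exact: fine_ge0.
have bound3 : l%:E * V tau <= (A * (4 * pi))%:E * lorentz_norm p u w (fun x => (f x)%:E).
  (* For [tau > 0], [tau / 2] lies strictly below [nu O], hence below [nu G1]; for [tau = 0] the
     left side vanishes. *)
  have [tau0|tau0] := ltP 0%R tau.
    apply: bound1 => //; apply: lt_le_trans OG1.
    by rewrite -(fineK On) lte_fin -/tau; lra.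
  have -> : tau = 0%R by apply/eqP; rewrite eq_le tau0.
  by rewrite Wfun0 poweR0r ?mule0 ?mule_ge0// invr_neq0// gt_eqF.
apply: (@le_trans _ _ ((A * (8 * pi))%:E * (l%:E * V tau))).
  rewrite [X in _ <= X]muleCA; apply: lee_wpmul2l => //; by rewrite lee_fin ltW.
apply: (@le_trans _ _ ((A * (8 * pi))%:E *
    ((A * (4 * pi))%:E * lorentz_norm p u w (fun x => (f x)%:E)))).
  by apply: lee_wpmul2l.
rewrite muleA -EFinM; apply: lee_wpmul2r => //.
by rewrite lee_fin mcE lerDr.
Qed.

Lemma maximal_weak_lorentz (f : R -> R) : in_lorentz p u w f ->
  weak_lorentz_norm p u w (maximal f)
    <= maximal_const%:E * lorentz_norm p u w (fun x => (f x)%:E).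
Proof.
move=> Lf; have [mf Nf] := Lf.
set N := lorentz_norm _ _ _ _ in Nf *.
have N0 : 0 <= N by exact: poweR_ge0.
have Nfin : N \is a fin_num by rewrite ge0_fin_numE.
have pi0 : (0 <= pi :> R)%R by exact: pi_ge0.
have A0 : (0 <= (27 * pi * C) ^+ 2 * C)%R by rewrite mulr_ge0 ?sqr_ge0.
have B0 : (0 <= maximal_const)%R.
  by rewrite /maximal_const; apply: addr_ge0; rewrite !mulr_ge0// !mulr_ge0.
apply: ge_ereal_sup => _ [t t0 <-].
have Vfin : V t \is a fin_num by rewrite fin_num_poweR// ge0_fin_numE ?Wfun_ge0 ?Wfun_lty.
have V0 : 0 <= V t by exact: poweR_ge0.
(* When [V t = 0] the product is 0 even if the rearrangement is infinite. *)
have [V1|V1] := ltP 0 (V t); last first.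
  have -> : V t = 0 by apply/eqP; rewrite eq_le V1 V0.
  by rewrite mule0 mule_ge0.
rewrite leNgt; apply/negP => lt.
(* A real level below the rearrangement that still violates the bound: a midpoint when the
   rearrangement is finite, the critical ratio plus 1 when it is infinite. Being below the infimum,
   [l] is not admissible, so its level set has measure above [t]. *)
have [l l1 l2] : exists2 l : R, (l%:E < rearr u (maximal f) t) & maximal_const%:E * N < l%:E * V t.
  move: lt V1; rewrite -(fineK Nfin) -(fineK Vfin).
  move: (fine N) (fine (V t)) => r v; rewrite -EFinM lte_fin.
  case: (rearr u (maximal f) t) => [y| |]; last by move=> + v0; rewrite gt0_mulNye.
    rewrite -EFinM lte_fin => rv v0.
    exists ((maximal_const * r / v + y) / 2)%R.
      by rewrite lte_fin; move: rv; rewrite -ltr_pdivrMr//; lra.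
    rewrite -EFinM lte_fin; move: rv; rewrite -!ltr_pdivrMr//; lra.
  move=> _ v0; exists (maximal_const * r / v + 1)%R; first exact: ltry.
  by rewrite -EFinM lte_fin -ltr_pdivrMr// ltrDl.
have l0 : (0 < l)%R.
  have : 0 < l%:E * V t by apply: le_lt_trans l2; rewrite mule_ge0.
  by rewrite pmule_lgt0// lte_fin.
move: l2; apply/negP; rewrite -leNgt.
apply: maximal_gt_weak_type => //.
rewrite -(umeasE wu); last exact: measurable_maximal_gt.
rewrite ltNge; apply/negP => tl; move: l1; apply/negP; rewrite -leNgt.
apply: ereal_inf_lbound; exists l => //; split => //.
rewrite (_ : [set x | _] = [set x | l%:E < maximal f x])//.
by apply/seteqP; split=> x /=; rewrite gee0_abs// maximal_ge0.
Qed.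

End maximal_weak_type.

Theorem theorem3p9 (R : realType) (p : R) (u w : R -> R) :
  0 < p -> weightR u -> weightRplus w ->
  (* H : Lambda^p_u(w) -> Lambda^{p,oo}_u(w) bounded *)
  (exists C : R, forall f : R -> R, in_lorentz p u w f ->
     exists Hf : R -> R, measurable_fun setT Hf /\ is_hilbert f Hf /\
       (weak_lorentz_norm p u w (fun x => (Hf x)%:E)
          <= C%:E * lorentz_norm p u w (fun x => (f x)%:E))%E) ->
  (* M : Lambda^p_u(w) -> Lambda^{p,oo}_u(w) bounded *)
  (exists C : R, forall f : R -> R, in_lorentz p u w f ->
     (weak_lorentz_norm p u w (maximal f)
        <= C%:E * lorentz_norm p u w (fun x => (f x)%:E))%E).
Proof.
(* The given constant may be negative; its absolute value is also a valid bound and is nonnegative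
   as the argument requires. *)
move=> p0 wu ww [C HC]; exists (maximal_const `|C|) => f Lf.
apply: (maximal_weak_lorentz p0 wu ww (normr_ge0 C) _ Lf) => g Lg.
have [Hg [mHg [pvg Hle]]] := HC _ Lg; exists Hg; split=> //; split=> //.
apply: (le_trans Hle); apply: lee_wpmul2r; first exact: poweR_ge0.
by rewrite lee_fin ler_norm.
Qed.
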